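(* Let $a,b$ be positive integers and let $R=\langle b^a\rangle$ be the partition whose Young diagram is the $a\times b$ rectangle. For a partition $\lambda\subseteq R$ let $\lambda^{\mathrm c}$ denote its complement with respect to $R$. Then the squares of the self-complementary Schur functions, $s_\lambda^2$ for $\lambda=\lambda^{\mathrm c}$, are linearly independent of all other products $s_\mu s_{\mu^{\mathrm c}}$, $\mu\subseteq R$. That is: if $$\sum_{\{\mu,\mu^{\mathrm c}\}} k_{\{\mu,\mu^{\mathrm c}\}}\, s_\mu s_{\mu^{\mathrm c}}=0$$ is a linear relation with rational coefficients, the sum being over all unordered pairs $\{\mu,\mu^{\mathrm c}\}$ with $\mu\subseteq R$, then $k_{\{\lambda,\lambda^{\mathrm c}\}}=0$ for every $\lambda\subseteq R$ with $\lambda=\lambda^{\mathrm c}$. Moreover, if $a$ and $b$ are both odd, then the products $s_\lambda s_{\lambda^{\mathrm c}}$ for $\lambda$ almost self-complementary, indexed by the unordered pairs $\{\lambda,\lambda^{\mathrm c}\}$, are linearly independent.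
   Context: A partition is a weakly decreasing sequence $\lambda=\langle\lambda_1,\lambda_2,\ldots\rangle$ of nonnegative integers with finitely many nonzero terms, identified with its Young diagram (stacked rows of $\lambda_1,\lambda_2,\ldots$ boxes, left-justified, first row on top). One writes $\lambda\subseteq\mu$ if $\lambda_i\le\mu_i$ for all $i$. The Schur functions $s_\lambda$ are elements of the ring $\Lambda$ of symmetric functions in infinitely many variables $x_1,x_2,\ldots$ (with rational coefficients), of which they form a linear basis; $s_{\langle 0\rangle}=1$. Complement: for $\lambda\subseteq R=\langle b^a\rangle$, the complement $\lambda^{\mathrm c}$ with respect to $R$ is the partition obtained by removing $\lambda$ from the upper left corner of $R$ and rotating the remaining boxes by $180^\circ$; explicitly $(\lambda^{\mathrm c})_i=b-\lambda_{a+1-i}$ for $1\le i\le a$ and $(\lambda^{\mathrm c})_i=0$ for $i>a$. A partition $\lambda\subseteq R$ (and $s_\lambda$) is self-complementary if $\lambda=\lambda^{\mathrm c}$. If $a$ and $b$ are both odd there are no self-complementary $\lambda$; in this case $\lambda\subseteq R$ is called almost self-complementary if $\lambda$ and $\lambda^{\mathrm c}$ differ only in which one contains the central box of $R$ (the box in row $\frac{a+1}{2}$ and column $\frac{b+1}{2}$), i.e. the diagrams of $\lambda$ and $\lambda^{\mathrm c}$ agree except that exactly one of them contains the central box. *)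

(* Defs.v *)
From HB Require Import structures.
From mathcomp Require Import all_boot all_order all_algebra finmap.
From mathcomp.multinomials Require Import monalg.
From mathcomp Require Import boolp classical_sets cardinality.

Set Implicit Arguments.
Unset Strict Implicit.
Unset Printing Implicit Defensive.

Import GRing.Theory.

Local Open Scope ring_scope.

(* Formal power series over the rationals in the variables x_0, x_1, x_2, ... *)
(* given by their coefficients on monomials, a monomial being a finitely      *)
(* supported exponent vector. The ring of symmetric functions is the subring  *)
(* of the symmetric series of bounded degree, so that a linear relation       *)
(* between symmetric functions is a linear relation in this ring.             *)
Record powser : predArgType := PowSer { pcoef : {cmonom nat} -> rat }.

HB.instance Definition _ := [isNew for pcoef].
HB.instance Definition _ := [Choice of powser by <:].

Lemma powserP (f g : powser) : pcoef f =1 pcoef g -> f = g.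
Proof. by case: f g => [f] [g] /= /funext ->. Qed.

Definition pszero : powser := PowSer (fun=> 0).
Definition psopp f : powser := PowSer (fun m => - pcoef f m).
Definition psadd f g : powser := PowSer (fun m => pcoef f m + pcoef g m).
Definition psscale c f : powser := PowSer (fun m => c * pcoef f m).
Definition psone : powser := PowSer (fun m => (m == mone)%:R).

(* fset_set sends infinite sets to fset0, hence this finiteness result and    *)
(* finite_ssyt_content below.                                                 *)
Lemma finite_mfactor (m : {cmonom nat}) :
  finite_set [set p : {cmonom nat} * {cmonom nat} | mmul p.1 p.2 = m]%classic.
Proof.
set B := \max_(i <- finsupp m) m i.
pose mk (h : {ffun finsupp m -> 'I_B.+1}) : {cmonom nat} :=
  mkcmonom [fsfun i : finsupp m => nat_of_ord (h i) | 0%N].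
pose D := [fset mk h | h in {ffun finsupp m -> 'I_B.+1}]%fset.
have mD u v : mmul u v = m -> u \in D.
  move=> uvm; have uE i : (u i <= m i)%N by rewrite -uvm cmM leq_addr.
  apply/imfsetP; exists [ffun i : finsupp m => inord (u (val i))] => //.
  apply/eqP/cmP => i; rewrite cmE /= fsfun_ffun.
  case: insubP => /= [j jm ji|im].
    rewrite ffunE inordK ji // ltnS (leq_trans (uE i)) //.
    by apply: leq_bigmax_seq.
  by apply/eqP; rewrite -leqn0 (leq_trans (uE i)) // leqn0 -memNfinsupp.
apply: (@sub_finite_set _ _ [set` (D `*` D)%fset]%classic);
  last exact: finite_fset.
move=> [u v] /= uvm; rewrite inE /= (mD u v uvm).
by apply: (mD v u); rewrite mulmC.
Qed.

Definition psmul f g : powser := PowSer (fun m =>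
  \sum_(p <- fset_set [set p | mmul p.1 p.2 = m]%classic) pcoef f p.1 * pcoef g p.2).

Lemma pcoef_psmul (D : {fset {cmonom nat}}) f g m :
    (forall u v, mmul u v = m -> u \in D) ->
  pcoef (psmul f g) m =
  \sum_(u <- D) \sum_(v <- D | mmul u v == m) pcoef f u * pcoef g v.
Proof.
move=> mD; transitivity (\sum_(p <- [seq (u, v) | u <- D, v <- D] |
    mmul p.1 p.2 == m) pcoef f p.1 * pcoef g p.2); last first.
  rewrite big_mkcond big_allpairs; apply: eq_bigr => u _.
  by rewrite [RHS]big_mkcond.
rewrite /= -[RHS]big_filter.
apply: perm_big; apply: uniq_perm; first exact: fset_uniq.
  by rewrite filter_uniq // allpairs_uniq ?fset_uniq // => -[? ?] [? ?].
move=> [u v]; rewrite in_fset_set; last exact: finite_mfactor.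
rewrite mem_filter /=; apply/idP/andP => [|[/eqP uvm _]]; last exact/mem_set.
move=> /set_mem /= uvm; split; first exact/eqP.
apply/allpairsP; exists (u, v) => /=; split => //; first exact: (mD _ v).
by apply: (mD v u); rewrite mulmC.
Qed.

Fact psaddA : associative psadd.
Proof. by move=> f g h; apply: powserP => m /=; rewrite addrA. Qed.
Fact psaddC : commutative psadd.
Proof. by move=> f g; apply: powserP => m /=; rewrite addrC. Qed.
Fact psadd0 : left_id pszero psadd.
Proof. by move=> f; apply: powserP => m /=; rewrite add0r. Qed.
Fact psaddN : left_inverse pszero psopp psadd.
Proof. by move=> f; apply: powserP => m /=; rewrite addNr. Qed.

HB.instance Definition _ :=
  GRing.isZmodule.Build powser psaddA psaddC psadd0 psaddN.

Definition mdivisors (m : {cmonom nat}) : {fset {cmonom nat}} :=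
  [fset p.1 | p in fset_set [set p | mmul p.1 p.2 = m]%classic]%fset.

Lemma mdivisorsP m u :
  reflect (exists v, mmul u v = m) (u \in mdivisors m).
Proof.
apply: (iffP (imfsetP _ _ _ _)) => [[[x y]]|[v uvm]] /=.
  rewrite in_fset_set; last exact: finite_mfactor.
  by move=> /set_mem /= <- ->; exists y.
exists (u, v) => //; rewrite /= in_fset_set; last exact: finite_mfactor.
exact/mem_set.
Qed.

Fact psmulC : commutative psmul.
Proof.
move=> f g; apply: powserP => m.
have mD u v : mmul u v = m -> u \in mdivisors m.
  by move=> uvm; apply/mdivisorsP; exists v.
rewrite !(pcoef_psmul _ _ mD) (exchange_big_dep predT) //=.
apply: eq_bigr => u _; apply: eq_big => v; first by rewrite mulmC.
by rewrite mulrC.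
Qed.

Lemma sum_pred1_fset (K : choiceType) (D : {fset K}) (F : K -> rat) x :
  x \in D -> \sum_(y <- D | y == x) F y = F x.
Proof. by move=> xD; rewrite (@fbig_pred1_inj _ _ _ _ _ F id). Qed.

Lemma pcoef_psmul3 f g h m :
  pcoef (psmul f (psmul g h)) m =
  \sum_(u <- mdivisors m) \sum_(v <- mdivisors m)
    \sum_(w <- mdivisors m | mmul u (mmul v w) == m)
      pcoef f u * (pcoef g v * pcoef h w).
Proof.
have mD u v : mmul u v = m -> u \in mdivisors m.
  by move=> uvm; apply/mdivisorsP; exists v.
rewrite (pcoef_psmul _ _ mD); apply: eq_bigr => u _.
under eq_bigr => q /eqP uqm.
  rewrite (@pcoef_psmul (mdivisors m)); last first.
    move=> v w vwq; apply/mdivisorsP; exists (mmul w u).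
    by rewrite mulmA vwq mulmC.
  rewrite mulr_sumr.
  under eq_bigr do rewrite mulr_sumr.
  over.
rewrite exchange_big; apply: eq_bigr => v _.
rewrite (exchange_big_dep predT) //= [RHS]big_mkcond; apply: eq_bigr => w _.
case: eqP => [uvwm|uvwm].
  rewrite -[RHS](@sum_pred1_fset _ (mdivisors m) (fun=> _) (mmul v w)).
    apply: eq_bigl => q /=; rewrite andbC [q == _]eq_sym; case: eqP => //= <-.
    exact/eqP.
  by apply: (mD _ u); rewrite mulmC.
by rewrite big1 // => q /andP[/eqP uqm /eqP vwq]; case: uvwm; rewrite vwq.
Qed.

Fact psmulA : associative psmul.
Proof.
move=> f g h; apply: powserP => m.
rewrite [psmul (psmul f g) h]psmulC !pcoef_psmul3 [RHS]exchange_big.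
apply: eq_bigr => u _; rewrite [RHS](exchange_big_dep predT) //=.
apply: eq_bigr => v _; apply: eq_big => w.
  by rewrite [mmul w _]mulmC mulmA.
by rewrite mulrA mulrC.
Qed.

Fact psmul1 : left_id psone psmul.
Proof.
move=> f; apply: powserP => m.
have mD u v : mmul u v = m -> u \in mdivisors m.
  by move=> uvm; apply/mdivisorsP; exists v.
rewrite (pcoef_psmul _ _ mD) (big_fsetD1 mone) /=; last first.
  by apply/(mD _ m); rewrite mul1m.
rewrite [X in _ + X]big1_seq ?addr0 => [|u /=]; last first.
  rewrite in_fsetD1 => /andP[/negPf u1 _].
  by apply: big1 => v _; rewrite u1 mul0r.
under eq_bigl do rewrite mul1m.
rewrite sum_pred1_fset ?eqxx ?mul1r //.
by apply: (mD _ mone); rewrite mulm1.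
Qed.

Fact psmulD : left_distributive psmul psadd.
Proof.
move=> f g h; apply: powserP => m /=; rewrite -big_split.
by apply: eq_bigr => p _; rewrite mulrDl.
Qed.

Fact psone_neq0 : psone != pszero.
Proof. by apply/eqP => /(congr1 (pcoef^~ mone)) /=; rewrite eqxx. Qed.

HB.instance Definition _ := GRing.Zmodule_isComNzRing.Build powser
  psmulA psmulC psmul1 psmulD psone_neq0.

Fact psscaleA c d f : psscale c (psscale d f) = psscale (c * d) f.
Proof. by apply: powserP => m /=; rewrite mulrA. Qed.
Fact psscale1 : left_id 1 psscale.
Proof. by move=> f; apply: powserP => m /=; rewrite mul1r. Qed.
Fact psscaleDr : right_distributive psscale psadd.
Proof. by move=> c f g; apply: powserP => m /=; rewrite mulrDr. Qed.
Fact psscaleDl f : {morph psscale^~ f : c d / c + d >-> psadd c d}.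
Proof. by move=> c d; apply: powserP => m /=; rewrite mulrDl. Qed.

HB.instance Definition _ := GRing.Zmodule_isLmodule.Build rat powser
  psscaleA psscale1 psscaleDr psscaleDl.

Fact psscaleAl c (f g : powser) : c *: (f * g) = (c *: f) * g.
Proof.
apply: powserP => m /=; rewrite mulr_sumr.
by apply: eq_bigr => p _; rewrite mulrA.
Qed.

HB.instance Definition _ := GRing.Lmodule_isLalgebra.Build rat powser psscaleAl.
HB.instance Definition _ := GRing.Lalgebra_isComAlgebra.Build rat powser.

(* A shape is the list of its row lengths (trailing zeros are allowed), a     *)
(* filling the list of its rows, and entry i of a filling stands for x_i.     *)
(* Rows increase weakly from left to right and columns strictly downwards.    *)
Definition column_lt (r1 r2 : seq nat) : bool :=
  all (fun j => nth 0 r1 j < nth 0 r2 j)%N (iota 0 (size r2)).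

Definition is_ssyt (la : seq nat) (T : seq (seq nat)) : bool :=
  [&& map size T == la, all (sorted leq) T & sorted column_lt T].

Definition ssyt_content (la : seq nat) (m : {cmonom nat}) : set (seq (seq nat)) :=
  [set T | is_ssyt la T /\ forall i, count_mem i (flatten T) = m i]%classic.

Lemma finite_ssyt_content la m : finite_set (ssyt_content la m).
Proof.
pose w := flatten [seq nseq (m i) i | i <- finsupp m].
apply: (@sub_finite_set _ _ [set` [seq reshape la s | s <- permutations w]]%classic);
  last exact: finite_seq.
move=> T [/and3P[/eqP shT _ _] cT] /=.
apply/mapP; exists (flatten T); last by rewrite -shT flattenK.
rewrite mem_permutations; apply/allP => i _ /=; apply/eqP.
rewrite cT count_flatten -map_comp sumnE big_map.
under eq_bigr do rewrite /= count_nseq /= [_ == i]eq_sym.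
case: (finsuppP m i) => im.
  rewrite big1_seq // => j /= jm; case: eqP => [ij|]; last by rewrite mul0n.
  by rewrite ij jm in im.
rewrite (big_fsetD1 i) //= eqxx mul1n big1_seq ?addn0 // => j /=.
by rewrite in_fsetD1 eq_sym => /andP[/negPf -> _]; rewrite mul0n.
Qed.

Definition schur (la : seq nat) : powser :=
  PowSer (fun m => #|` fset_set (ssyt_content la m)|%:R).

(* The partitions contained in the rectangle <b^a>: the parts of index at     *)
(* most a, the later ones being zero.                                         *)
Definition is_rpart a b (la : {ffun 'I_a -> 'I_b.+1}) : bool :=
  [forall i : 'I_a, forall j : 'I_a, (i <= j)%N ==> (la j <= la i)%N].

Record rpart a b : predArgType :=
  RPart { rpart_val :> {ffun 'I_a -> 'I_b.+1}; _ : is_rpart rpart_val }.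

HB.instance Definition _ a b := [isSub for @rpart_val a b].
HB.instance Definition _ a b := [Finite of rpart a b by <:].

Definition parts a b (la : rpart a b) : seq nat :=
  [seq nat_of_ord (la i) | i <- enum 'I_a].

Fact complement_proof a b (la : rpart a b) :
  is_rpart [ffun i => rev_ord (la (rev_ord i))].
Proof.
case: la => la /= /forallP/(_ _)/forallP laP.
apply/forallP => i; apply/forallP => j; apply/implyP => ij; rewrite !ffunE /=.
by rewrite leq_sub2l // ltnS (implyP (laP _ _)) //= leq_sub2l.
Qed.

Definition complement a b (la : rpart a b) : rpart a b :=
  RPart (complement_proof la).

Lemma complementE a b (la : rpart a b) i :
  complement la i = (b - la (rev_ord i))%N :> nat.
Proof. by rewrite ffunE /= subSS. Qed.

Lemma complementK a b : involutive (@complement a b).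
Proof.
by move=> la; apply/val_inj/ffunP => i; rewrite !ffunE !rev_ordK.
Qed.

Definition diagram a b (la : rpart a b) : {set 'I_a * 'I_b} :=
  [set x : 'I_a * 'I_b | (x.2 < la x.1)%N].

(* With rows and columns numbered from 0 and a, b odd, the central box is     *)
(* (a./2, b./2).                                                              *)
Definition almost_selfcomplementary a b (la : rpart a b) : bool :=
  let D := diagram la in let Dc := diagram (complement la) in
  (D :\: Dc) :|: (Dc :\: D)
    == [set x : 'I_a * 'I_b | (x.1 == a./2 :> nat) && (x.2 == b./2 :> nat)].

Definition cpair a b (la : rpart a b) : {set rpart a b} :=
  [set la; complement la].

(* The product s_la * s_(la^c), as a function of the unordered pair.          *)
Definition cpair_prod a b (P : {set rpart a b}) : powser :=
  if [pick la in P] is Some la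
  then schur (parts la) * schur (parts (complement la)) else 0.

Lemma cpair_prodE a b (la : rpart a b) :
  cpair_prod (cpair la) = schur (parts la) * schur (parts (complement la)).
Proof.
rewrite /cpair_prod; case: pickP => [mu|/(_ la)]; rewrite in_set2.
  by case/orP => /eqP -> //; rewrite complementK mulrC.
by rewrite eqxx.
Qed.

(* Main.v *)
Require Import Defs.
From mathcomp Require Import all_boot all_order all_algebra finmap zify lra.
From mathcomp.multinomials Require Import monalg.
From mathcomp Require Import boolp classical_sets cardinality.

Set Implicit Arguments.
Unset Strict Implicit.
Unset Printing Implicit Defensive.

Import GRing.Theory.

Local Open Scope ring_scope.

(** A linear relation between products of two Schur functions is a function c
on pairs (mu, kappa) of partitions with sum c(mu, kappa) s_mu s_kappa = 0.  Two
operations turn relations into relations.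

- Take the coefficient of x_n^k, where n exceeds the index of every other
  variable that is kept.  By the branching rule [card_ssyt_setm] the product
  s_mu s_kappa becomes the sum of the s_rho s_sigma such that mu / rho and
  kappa / sigma are horizontal strips with k boxes in total: [relation_hop].
- Remove vertical strips instead: [relation_vop].  With generating series in k,
  removing horizontal strips and removing vertical strips with signs are
  inverse to each other (they are adjoint to the multiplications by the series
  of the h_k and of the e_k), so that the second operation is a polynomial in
  the operations of the first kind.  The cancellation is [strip_sign].

Now let c be supported on pairs which are complementary in a rectangle with h
rows and w columns.  A horizontal strip in mu has at most mu_0 <= w boxes, so
removing 2w boxes from mu and kappa together is possible only if both first
rows are full, and amounts to deleting them: the relation that is obtained is
supported on complementary pairs in the rectangle with h - 2 rows and w
columns.  Likewise removing 2h boxes in vertical strips selects the pairs in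
which both first columns are full, and leads to h rows and w - 2 columns.  In
both cases a coefficient of the new relation is a single coefficient of the old
one.

A pair whose two members agree, or differ in the central box only, survives one
of the two operations, unless the rectangle is empty or a single box: as the
first row of one member and the last row of the other have w boxes in total,
either both first rows are full, or both last rows are nonempty, that is, both
first columns are full.  Both operations keep the two members equal, or
different in the central box only.  The pair is therefore stripped down to the
empty rectangle, where c vanishes because s_0 s_0 = 1 is not zero, or to the
rectangle with one box, where the sum of the coefficients of the pair and of the
swapped pair vanishes.  This is [relation_near_equal], and it gives both parts
of the theorem, even with all the other products allowed in the relation. *)

(** * Coefficients with respect to one variable *)

(** The monomial m with the exponent of the n-th variable changed to k; it is m
times the k-th power of that variable when the exponent was zero. *)
Definition setm (m : {cmonom nat}) (n k : nat) : {cmonom nat} :=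
  mkcmonom [fsfun i in (n |` finsupp m)%fset => if i == n then k else m i | 0%N].

Lemma setmE m n k i : setm m n k i = if i == n then k else m i.
Proof.
rewrite cmE fsfun_fun in_fsetE in_fset1; case: eqP => //= _.
by case: finsuppP.
Qed.

Lemma setm_id m n : setm m n (m n) = m.
Proof. by apply/eqP/cmP => i; rewrite setmE; case: eqP => // ->. Qed.

Lemma setm_setm m n k l : setm (setm m n k) n l = setm m n l.
Proof. by apply/eqP/cmP => i; rewrite !setmE; case: eqP. Qed.

Lemma mmul_setm u v n k l :
  mmul (setm u n k) (setm v n l) = setm (mmul u v) n (k + l).
Proof.
by apply/eqP/cmP => i; rewrite !(cmM, setmE); case: eqP.
Qed.

Definition factors (m : {cmonom nat}) : {fset {cmonom nat} * {cmonom nat}} :=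
  fset_set [set p | mmul p.1 p.2 = m]%classic.

Lemma in_factors m p : (p \in factors m) = (mmul p.1 p.2 == m).
Proof.
rewrite in_fset_set; last exact: finite_mfactor.
by apply/idP/eqP => [/set_mem|] //=; last exact/mem_set.
Qed.

(** In a factorisation of a monomial, the exponent of one variable is split
independently of the others. *)
Lemma sum_factors_setm (F : {cmonom nat} -> {cmonom nat} -> rat)
    (m : {cmonom nat}) n k :
    m n = 0%N ->
  \sum_(p <- factors (setm m n k)) F p.1 p.2 =
  \sum_(i < k.+1) \sum_(p <- factors m)
     F (setm p.1 n i) (setm p.2 n (k - i)).
Proof.
move=> mn; rewrite (partition_big (fun p : {cmonom nat} * {cmonom nat} =>
  inord (p.1 n) : 'I_k.+1) xpredT) //=.
apply: eq_bigr => i _; rewrite -big_filter.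
pose g (p : {cmonom nat} * {cmonom nat}) := (setm p.1 n i, setm p.2 n (k - i)).
rewrite -(big_map g xpredT (fun p => F p.1 p.2)); apply: perm_big.
have ik : (i <= k)%N by rewrite -ltnS.
have f0 p : p \in factors m -> p.1 n = 0%N /\ p.2 n = 0%N.
  rewrite in_factors => /eqP pm; have := mn; rewrite -pm cmM.
  by move/eqP; rewrite addn_eq0 => /andP[/eqP -> /eqP ->].
have gK p : p \in factors m -> (setm (g p).1 n 0, setm (g p).2 n 0) = p.
  by case: p => u v /f0 /= [u0 v0]; rewrite !setm_setm -{1}u0 -{2}v0 !setm_id.
apply: uniq_perm; first by rewrite filter_uniq // fset_uniq.
  rewrite map_inj_in_uniq ?fset_uniq // => p q pm qm pq.
  by rewrite -(gK p pm) -(gK q qm) pq.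
move=> [u v]; rewrite mem_filter; apply/idP/mapP => /=.
  rewrite in_factors /= => /andP[/eqP ui /eqP uv].
  have uvn : (u n + v n = k)%N by rewrite -cmM uv setmE eqxx.
  have {}ui : u n = i by rewrite -ui inordK // ltnS -uvn leq_addr.
  have vi : v n = (k - i)%N by lia.
  exists (setm u n 0, setm v n 0).
    by rewrite in_factors /= mmul_setm uv setm_setm -{2}mn setm_id.
  by rewrite /g /= !setm_setm -vi -ui !setm_id.
case=> -[u' v'] /= uv' [-> ->]; move: (uv'); rewrite !in_factors /= => /eqP uvm.
rewrite mmul_setm uvm subnKC // eqxx andbT; apply/eqP/val_inj.
by rewrite /= setmE eqxx inordK.
Qed.

(** * Branching of the tableaux: removing the entries of largest value *)

Section Rows.
Variables a b : nat.
Implicit Types (mu rho : rpart a b) (m : {cmonom nat}) (T : seq (seq nat)).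

(** Row lengths are indexed by all natural numbers, with value 0 from a on, so
that a statement about rows needs no bound. *)
Definition rowlen mu i := nth 0%N (parts mu) i.

Lemma size_parts mu : size (parts mu) = a.
Proof. by rewrite size_map size_enum_ord. Qed.

Lemma rowlenE mu (i : 'I_a) : rowlen mu i = mu i.
Proof. by rewrite /rowlen (nth_map i) ?size_enum_ord // nth_ord_enum. Qed.

Lemma row_over mu i : (a <= i)%N -> rowlen mu i = 0%N.
Proof. by move=> ai; rewrite /rowlen nth_default // size_parts. Qed.

Lemma row_leS mu i : (rowlen mu i.+1 <= rowlen mu i)%N.
Proof.
case: (ltnP i.+1 a) => [ia|/row_over -> //].
have /forallP/(_ (Ordinal (ltnW ia)))/forallP/(_ (Ordinal ia)) := valP mu.
by rewrite /= leqnSn /= -!rowlenE.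
Qed.

Lemma row_le mu i j : (i <= j)%N -> (rowlen mu j <= rowlen mu i)%N.
Proof.
elim: j => [|j IH]; first by rewrite leqn0 => /eqP ->.
rewrite leq_eqVlt => /orP[/eqP -> //|]; rewrite ltnS => /IH.
by apply: leq_trans; apply: row_leS.
Qed.

Lemma row_leb mu i : (rowlen mu i <= b)%N.
Proof.
case: (ltnP i a) => [ia|/row_over -> //].
by rewrite (rowlenE mu (Ordinal ia)) -ltnS.
Qed.

Lemma row_inj mu rho : (forall i, rowlen mu i = rowlen rho i) -> mu = rho.
Proof.
move=> eq_row; apply/val_inj/ffunP => i; apply/val_inj.
by rewrite /= -!rowlenE eq_row.
Qed.

Lemma rpart_exists (f : nat -> nat) :
    (forall i, (i < a)%N -> (f i <= b)%N) ->
    (forall i, (i.+1 < a)%N -> (f i.+1 <= f i)%N) ->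
  exists mu, forall i, (i < a)%N -> rowlen mu i = f i.
Proof.
move=> fb fS.
have f_le i j : (j < a)%N -> (i <= j)%N -> (f j <= f i)%N.
  elim: j => [|j IH] ja; first by rewrite leqn0 => /eqP ->.
  rewrite leq_eqVlt => /orP[/eqP -> //|]; rewrite ltnS => ij.
  exact: leq_trans (fS _ ja) (IH (ltnW ja) ij).
have fP : is_rpart [ffun i : 'I_a => inord (f i) : 'I_b.+1].
  apply/forallP => i; apply/forallP => j; apply/implyP => ij.
  by rewrite !ffunE !inordK ?ltnS ?fb // f_le.
exists (RPart fP) => i ia.
by rewrite (rowlenE _ (Ordinal ia)) /= ffunE inordK // ltnS fb.
Qed.

Definition wt mu := (\sum_(i < a) rowlen mu i)%N.

Lemma wtE mu : wt mu = sumn (parts mu).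
Proof.
by rewrite /wt sumnE (big_nth 0%N) size_parts big_mkord.
Qed.

(** Interlacing of the row lengths: no column of mu has two boxes outside rho. *)
Definition hstrip mu rho :=
  [forall i : 'I_a, (rowlen rho i <= rowlen mu i)%N && (rowlen mu i.+1 <= rowlen rho i)%N].

Lemma hstripP mu rho :
  reflect (forall i, (rowlen mu i.+1 <= rowlen rho i <= rowlen mu i)%N) (hstrip mu rho).
Proof.
apply: (iffP forallP) => [h i|h i]; last by rewrite andbC h.
case: (ltnP i a) => [ia|ai]; first by have := h (Ordinal ia); rewrite andbC.
by rewrite !row_over // ltnW.
Qed.

Lemma hstrip_wt mu rho : hstrip mu rho -> (wt rho <= wt mu)%N.
Proof. by move/hstripP => hs; apply: leq_sum => i _; case/andP: (hs i). Qed.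

Definition ssyt mu m : {fset seq (seq nat)} := fset_set (ssyt_content (parts mu) m).

Lemma in_ssyt mu m T : (T \in ssyt mu m) =
  is_ssyt (parts mu) T && `[< forall i, count_mem i (flatten T) = m i >].
Proof.
rewrite in_fset_set; last exact: finite_ssyt_content.
apply/idP/andP => [/set_mem[h1 h2]|[h1 /asboolP h2]].
  by split=> //; apply/asboolP.
exact/mem_set.
Qed.

Lemma is_ssytP mu T : reflect
  [/\ map size T = parts mu,
      forall i, sorted leq (nth [::] T i) &
      forall i j, (j < rowlen mu i.+1)%N ->
        (nth 0%N (nth [::] T i) j < nth 0%N (nth [::] T i.+1) j)%N]
  (is_ssyt (parts mu) T).
Proof.
apply: (iffP and3P) => [[/eqP shT /allP sT /(sortedP [::]) cT]|[shT sT cT]].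
  have sizeT : size T = a by rewrite -(size_map size) shT size_parts.
  have rowT i : rowlen mu i = size (nth [::] T i).
    rewrite /rowlen -shT; case: (ltnP i (size T)) => iT; first by rewrite (nth_map [::]).
    by rewrite !nth_default ?size_map.
  split=> // [i|i j ij].
    case: (ltnP i (size T)) => iT; last by rewrite nth_default.
    by apply: sT; apply: mem_nth.
  have ia : (i.+1 < size T)%N.
    by rewrite sizeT ltnNge; apply/negP => /(row_over mu) E; rewrite E in ij.
  have /allP/(_ j) := cT i ia; rewrite mem_iota /= add0n -rowT => -> //.
split; first exact/eqP.
  by apply/allP => r /(nthP [::])[i iT <-].
apply/(sortedP [::]) => i iT; apply/allP => j; rewrite mem_iota /= add0n => jT.
by apply: cT; rewrite /rowlen -shT (nth_map [::]).
Qed.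

(** Truncation and padding are the two directions of the branching bijection:
the entries n of a tableau with all entries at most n form a horizontal strip,
and determine the tableau together with its part of entries less than n. *)
Definition truncate n (T : seq (seq nat)) := [seq [seq x <- r | (x < n)%N] | r <- T].

Definition pad n mu (T : seq (seq nat)) :=
  [seq nth [::] T i ++ nseq (rowlen mu i - size (nth [::] T i)) n | i <- iota 0 a].

(** In a weakly increasing row bounded by n, the entries n come last. *)
Lemma sorted_split n r : sorted leq r -> all (leq^~ n) r ->
  r = [seq x <- r | (x < n)%N] ++
      nseq (size r - size [seq x <- r | (x < n)%N]) n.
Proof.
elim: r => //= x r IH pr /andP[xn rn]; have sr := path_sorted pr.
case: ltnP => nx /=; first by rewrite subSS -IH.
have xE : x = n by apply/eqP; rewrite eqn_leq xn nx.
rewrite {}xE in pr *.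
have all_n y : y \in r -> y = n.
  move=> yr; apply/eqP; rewrite eqn_leq (allP rn _ yr) /=.
  exact: (allP (order_path_min leq_trans pr)).
have -> : [seq x <- r | (x < n)%N] = [::].
  apply/eqP; rewrite -[_ == _]negbK -has_filter; apply/hasPn => y /all_n ->.
  by rewrite ltnn.
rewrite /= -{1}(_ : nseq (size r) n = r) //.
by apply/esym/all_pred1P/allP => y /all_n ->; rewrite /=.
Qed.

Lemma count_setm (w : seq nat) (m : {cmonom nat}) n k :
    (forall i, (n <= i)%N -> m i = 0%N) ->
  (forall i, count_mem i w = setm m n k i) <->
  [/\ all (leq^~ n) w, forall i, count_mem i [seq x <- w | (x < n)%N] = m i
    & size w = (size [seq x <- w | (x < n)%N] + k)%N].
Proof.
move=> m_n; have count_lt i : count_mem i [seq x <- w | (x < n)%N] =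
    (if (i < n)%N then count_mem i w else 0)%N.
  rewrite count_filter; case: ltnP => ni; last first.
    rewrite -(count_pred0 w); apply: eq_count => x /=.
    by case: eqP => //= ->; rewrite ltnNge ni.
  by apply: eq_count => x /=; case: eqP => //= ->.
have size_n : all (leq^~ n) w ->
    size w = (size [seq x <- w | (x < n)%N] + count_mem n w)%N.
  move=> /allP wn; rewrite size_filter -(count_predC (fun x => x < n)%N w).
  congr addn; apply: eq_in_count => x /wn /= xn.
  by rewrite -leqNgt eqn_leq xn.
split=> [cw|[wn cw sw] i].
  have wn : all (leq^~ n) w.
    apply/allP => x xw; rewrite leqNgt; apply/negP => nx; move: (cw x).
    rewrite setmE gtn_eqF // m_n; last exact: ltnW.
    by move/eqP; rewrite -leqn0 leqNgt -has_count has_pred1 xw.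
  split=> // [i|]; last by rewrite (size_n wn) cw setmE eqxx.
  rewrite count_lt; case: ltnP => ni; last by rewrite m_n.
  by rewrite cw setmE ltn_eqF.
rewrite setmE; case: eqP => [->|/eqP i_n].
  by apply/eqP; rewrite -(eqn_add2l (size [seq x <- w | (x < n)%N])) -size_n // sw.
rewrite -cw count_lt; case: ltnP => // ni.
apply/eqP; rewrite -leqn0 leqNgt -has_count has_pred1; apply/negP => /(allP wn) /=.
by rewrite leqNgt ltn_neqAle eq_sym i_n ni.
Qed.

Lemma truncate_flatten n T :
  flatten (truncate n T) = [seq x <- flatten T | (x < n)%N].
Proof. by rewrite filter_flatten. Qed.

Lemma nth_truncate n T i :
  nth [::] (truncate n T) i = [seq x <- nth [::] T i | (x < n)%N].
Proof.
case: (ltnP i (size T)) => iT; first by rewrite (nth_map [::]).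
by rewrite !nth_default ?size_map.
Qed.

Lemma shape_row (T : seq (seq nat)) mu i : map size T = parts mu ->
  size (nth [::] T i) = rowlen mu i.
Proof.
rewrite /rowlen => <-; case: (ltnP i (size T)) => iT; first by rewrite (nth_map [::]).
by rewrite !nth_default ?size_map.
Qed.

Lemma shape_size (T : seq (seq nat)) mu : map size T = parts mu -> size T = a.
Proof. by rewrite -(size_map size) => ->; rewrite size_parts. Qed.

Lemma shape_wt (T : seq (seq nat)) mu : map size T = parts mu -> size (flatten T) = wt mu.
Proof. by rewrite wtE => <-; rewrite size_flatten. Qed.

Lemma all_flatten_nth T n i : all (leq^~ n) (flatten T) -> all (leq^~ n) (nth [::] T i).
Proof.
move=> /allP Tn; apply/allP => x xT; apply: Tn; apply/flattenP.
case: (ltnP i (size T)) => iT; last by rewrite nth_default in xT.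
by exists (nth [::] T i) => //; apply: mem_nth.
Qed.

Lemma nth_pad n mu T i : size T = a ->
  nth [::] (pad n mu T) i =
  nth [::] T i ++ nseq (rowlen mu i - size (nth [::] T i)) n.
Proof.
move=> Ta; case: (ltnP i a) => ia; first by rewrite (nth_map 0%N) ?size_iota ?nth_iota.
by rewrite row_over // !nth_default ?size_map ?size_iota ?Ta.
Qed.

Lemma truncate_pad n mu T : size T = a -> all (gtn n) (flatten T) ->
  truncate n (pad n mu T) = T.
Proof.
move=> Ta /allP Tn; apply: (@eq_from_nth _ [::]).
  by rewrite !size_map size_iota Ta.
move=> i; rewrite !size_map size_iota => ia.
rewrite nth_truncate nth_pad // filter_cat.
rewrite (all_filterP _) ?[X in _ ++ X](_ : _ = [::]) ?cats0 //.
  by elim: (_ - _)%N => //= l ->; rewrite ltnn.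
apply/allP => x xT; apply: Tn; apply/flattenP.
by exists (nth [::] T i) => //; rewrite mem_nth // Ta.
Qed.

Lemma pad_truncate n mu T :
    map size T = parts mu -> (forall i, sorted leq (nth [::] T i)) ->
    all (leq^~ n) (flatten T) ->
  pad n mu (truncate n T) = T.
Proof.
move=> shT sT Tn; have Ta := shape_size shT.
apply: (@eq_from_nth _ [::]); first by rewrite size_map size_iota Ta.
move=> i; rewrite size_map size_iota => ia.
rewrite nth_pad ?size_map // nth_truncate -(shape_row i shT) -sorted_split //.
exact: all_flatten_nth.
Qed.

(** Since columns are strict and entries are at most n, every box below an
entry n is missing; hence the boxes that are removed form a horizontal strip. *)
Lemma ssyt_truncate mu m n k T :
    (forall i, (n <= i)%N -> m i = 0%N) -> T \in ssyt mu (setm m n k) ->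
  exists rho, [/\ hstrip mu rho, wt mu = (wt rho + k)%N,
    truncate n T \in ssyt rho m & pad n mu (truncate n T) = T].
Proof.
move=> m_n; rewrite in_ssyt => /andP[/is_ssytP[shT sT cT] /asboolP].
case/(count_setm _ _ m_n) => Tn cm sz; have Ta := shape_size shT.
have szT i := shape_row i shT.
pose f i := size (nth [::] (truncate n T) i).
have fle i : (f i <= rowlen mu i)%N.
  by rewrite /f nth_truncate -szT size_filter count_size.
have padT : pad n mu (truncate n T) = T by apply: pad_truncate.
have nthT i : nth [::] T i = nth [::] (truncate n T) i ++ nseq (rowlen mu i - f i) n.
  by rewrite -{1}padT nth_pad // size_map.
have fge i : (rowlen mu i.+1 <= f i)%N.
  rewrite leqNgt; apply/negP => fi; have := cT i _ fi.
  rewrite nthT nth_cat ltnn subnn nth_nseq subn_gt0.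
  rewrite (leq_trans fi) ?row_leS // ltnNge.
  by rewrite (allP (all_flatten_nth i.+1 Tn)) // mem_nth // szT.
have [i ia|i ia|rho rhoE] := @rpart_exists f.
- exact: leq_trans (fle i) (row_leb _ _).
- exact: leq_trans (fle _) (fge i).
have rowrho i : rowlen rho i = f i.
  case: (ltnP i a) => ia; first exact: rhoE.
  by rewrite row_over // /f nth_default // size_map Ta.
have shR : map size (truncate n T) = parts rho.
  apply: (@eq_from_nth _ 0%N); first by rewrite size_parts !size_map Ta.
  by move=> i iT; rewrite (nth_map [::]) -?[RHS]/(rowlen rho i) ?rowrho // -(size_map size).
exists rho; split=> //.
- by apply/hstripP => i; rewrite rowrho fle fge.
- by rewrite -(shape_wt shT) -(shape_wt shR) truncate_flatten sz.
rewrite in_ssyt; apply/andP; split; last by apply/asboolP; rewrite truncate_flatten.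
apply/is_ssytP; split=> // [i|i j]; last first.
  rewrite rowrho => fj; have := cT i j (leq_trans fj (fle _)).
  rewrite !nthT !nth_cat -!/(f _) fj.
  by rewrite (leq_trans fj (leq_trans (fle _) (fge i))).
by rewrite nth_truncate sorted_filter // => ? ? ?; apply: leq_trans.
Qed.

Lemma ssyt_pad mu rho m n k T :
    (forall i, (n <= i)%N -> m i = 0%N) -> hstrip mu rho ->
    wt mu = (wt rho + k)%N -> T \in ssyt rho m ->
  [/\ pad n mu T \in ssyt mu (setm m n k), truncate n (pad n mu T) = T &
      map size T = parts rho].
Proof.
move=> m_n /hstripP hs wtE'; rewrite in_ssyt.
case/andP => /is_ssytP[shT sT cT] /asboolP cm.
have Ta := shape_size shT; have szT i := shape_row i shT.
have Tn : all (gtn n) (flatten T).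
  apply/allP => x xT /=; rewrite ltnNge; apply/negP => /m_n.
  by rewrite -cm; move/eqP; rewrite -leqn0 leqNgt -has_count has_pred1 xT.
have TK := @truncate_pad n mu T Ta Tn.
split=> //; rewrite in_ssyt.
have nthT i : nth [::] (pad n mu T) i =
    nth [::] T i ++ nseq (rowlen mu i - rowlen rho i) n by rewrite nth_pad // szT.
have nthTn i : all (gtn n) (nth [::] T i).
  case: (ltnP i a) => ia; last by rewrite nth_default ?Ta.
  apply/allP => x xT; apply: (allP Tn); apply/flattenP.
  by exists (nth [::] T i) => //; rewrite mem_nth // Ta.
have shP : map size (pad n mu T) = parts mu.
  apply: (@eq_from_nth _ 0%N); first by rewrite size_parts !size_map size_iota.
  move=> i; rewrite !size_map size_iota => ia.
  rewrite (nth_map [::]) ?size_map ?size_iota // nthT size_cat size_nseq szT subnKC //.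
  by have /andP[] := hs i.
apply/andP; split; last first.
  apply/asboolP/(count_setm _ _ m_n); rewrite -truncate_flatten TK; split=> //.
    apply/allP => x /flattenP[r /(nthP [::])[i _ <-]]; rewrite nthT mem_cat.
    case/orP => [/(allP (nthTn i)) /ltnW //|]; first by rewrite mem_nseq => /andP[_ /eqP ->].
  by rewrite (shape_wt shT) (shape_wt shP).
apply/is_ssytP; split=> // [i|i j ij].
  rewrite nthT !(sorted_pairwise leq_trans) pairwise_cat.
  rewrite -(sorted_pairwise leq_trans) sT /=; apply/andP; split.
    apply/allrelP => x y /(allP (nthTn i)) /ltnW xn.
    by rewrite mem_nseq => /andP[_ /eqP ->].
  elim: (_ - _)%N => //= l ->; rewrite andbT.
  by apply/allP => x; rewrite mem_nseq => /andP[_ /eqP ->].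
have /andP[hs1 hs2] := hs i; have jr := leq_trans ij hs1.
rewrite !nthT !nth_cat !szT jr; case: (ltnP j (rowlen rho i.+1)) => [jr'|rj]; first exact: cT.
rewrite nth_nseq ltn_sub2r // ?(leq_ltn_trans rj) //.
by apply: (allP (nthTn i)); rewrite mem_nth // szT.
Qed.

(** Branching rule: the shape rho occupied by the entries less than n sorts the
tableaux, and those with given rho correspond to tableaux of shape rho. *)
Lemma card_ssyt_setm mu m n k : (forall i, (n <= i)%N -> m i = 0%N) ->
  #|` ssyt mu (setm m n k)| =
  (\sum_(rho | hstrip mu rho && (wt mu == wt rho + k)) #|` ssyt rho m|)%N.
Proof.
move=> m_n.
have cardE (D : {fset seq (seq nat)}) : #|` D| = (\sum_(T <- D) 1)%N.
  by rewrite sum1_size.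
rewrite cardE.
transitivity (\sum_(T <- ssyt mu (setm m n k))
   \sum_(rho | hstrip mu rho && (wt mu == wt rho + k))
      (map size (truncate n T) == parts rho))%N.
  apply: eq_big_seq => T /(ssyt_truncate m_n)[rho [hs /eqP wtE' Tr _]].
  move: Tr; rewrite in_ssyt => /andP[/is_ssytP[shT _ _] _].
  rewrite (bigD1 rho) /=; last by rewrite hs.
  rewrite shT eqxx big1 // => sigma /andP[_ sr]; apply/eqP; rewrite eqb0.
  apply: contraNneq sr => rs; apply/eqP/row_inj => i.
  by rewrite /rowlen rs.
rewrite exchange_big /=; apply: eq_bigr => rho /andP[hs /eqP wtE'].
rewrite cardE sum1_size -(size_map (pad n mu)).
transitivity (size [seq T <- ssyt mu (setm m n k) |
    map size (truncate n T) == parts rho]).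
  by rewrite size_filter -sum1_count [RHS]big_mkcond; apply: eq_bigr => T _; case: eqP.
apply: perm_size; apply: uniq_perm; first by rewrite filter_uniq ?fset_uniq.
  rewrite map_inj_in_uniq ?fset_uniq // => T1 T2 T1r T2r eqT.
  have [_ T1K _] := ssyt_pad m_n hs wtE' T1r.
  by have [_ <- _] := ssyt_pad m_n hs wtE' T2r; rewrite -T1K eqT.
move=> T; rewrite mem_filter; apply/andP/mapP => [[/eqP shT TS]|[T' T'S ->]].
  have [sigma [_ _ Ts padT]] := ssyt_truncate m_n TS.
  exists (truncate n T) => //; rewrite (_ : rho = sigma) //.
  move: Ts; rewrite in_ssyt => /andP[/is_ssytP[shs _ _] _].
  by apply/row_inj => i; rewrite /rowlen -shT shs.
by have [-> -> ->] := ssyt_pad m_n hs wtE' T'S.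
Qed.

Definition hstrip2 (p q : rpart a b * rpart a b) :=
  hstrip p.1 q.1 && hstrip p.2 q.2.

Definition wt2 (p : rpart a b * rpart a b) := (wt p.1 + wt p.2)%N.

Definition schur2 (p : rpart a b * rpart a b) : powser :=
  schur (parts p.1) * schur (parts p.2).

(** The branching rule is applied to both factors, the power k of the variable
being shared between them in all possible ways. *)
Lemma schur2_setm p m n k : (forall i, (n <= i)%N -> m i = 0%N) ->
  pcoef (schur2 p) (setm m n k) =
  \sum_(q | hstrip2 p q && (wt2 p == wt2 q + k)%N) pcoef (schur2 q) m.
Proof.
move=> m_n; pose F mu (u : {cmonom nat}) : rat := pcoef (schur (parts mu)) u.
transitivity (\sum_(p0 <- factors (setm m n k)) F p.1 p0.1 * F p.2 p0.2); first by [].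
rewrite (sum_factors_setm (fun u v => F p.1 u * F p.2 v)) ?m_n //.
have FE mu (u : {cmonom nat}) l : (forall i, (n <= i)%N -> u i = 0%N) -> F mu (setm u n l) =
    \sum_(rho | hstrip mu rho && (wt mu == wt rho + l)%N) F rho u.
  by move=> u_n; rewrite /F /= -[X in X%:R]/(#|` ssyt _ _|) card_ssyt_setm // natr_sum.
rewrite (partition_big (fun q : rpart a b * rpart a b =>
  inord (wt p.1 - wt q.1) : 'I_k.+1) xpredT) //=.
apply: eq_bigr => l _.
transitivity (\sum_(p0 <- factors m) \sum_(q | hstrip2 p q &&
    (wt2 p == wt2 q + k)%N && (inord (wt p.1 - wt q.1) == l))
  F q.1 p0.1 * F q.2 p0.2); last by rewrite exchange_big.
apply: eq_big_seq => -[u v] /=; rewrite in_factors /= => /eqP uvm.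
have uv_n i : (n <= i)%N -> u i = 0%N /\ v i = 0%N.
  by move=> /m_n; rewrite -uvm cmM => /eqP; rewrite addn_eq0 => /andP[/eqP -> /eqP ->].
rewrite !FE => [|i /uv_n[]//|i /uv_n[]//].
rewrite big_distrlr pair_big /=; apply: eq_bigl => -[rho sigma] /=.
rewrite /hstrip2 /wt2 /= andbACA -!andbA.
case: (boolP (hstrip p.1 rho)) => //= /hstrip_wt w1.
case: (boolP (hstrip p.2 sigma)) => //= /hstrip_wt w2.
have := ltn_ord l; rewrite ltnS => lk.
apply/andP/andP => [[/eqP E1 /eqP E2]|[/eqP E /eqP El]].
  split; first by apply/eqP; lia.
  by apply/eqP/val_inj; rewrite /= E1 addKn inordK.
by have := congr1 val El; rewrite /= inordK => [E'|]; lia.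
Qed.

End Rows.

(** * Strips and their signs *)

Lemma eq_leq_sum a (f g : nat -> nat) : (forall i, (f i <= g i)%N) ->
  (\sum_(i < a) g i <= \sum_(i < a) f i)%N -> forall i, (i < a)%N -> f i = g i.
Proof.
move=> fg le_sum i ia.
have [_] := @leqif_sum _ xpredT _ (fun j : 'I_a => f j) (fun j : 'I_a => g j)
  (fun j _ => leqif_eq (fg j)).
rewrite eqn_leq le_sum leq_sum => [|j _]; last exact: fg.
by move/esym/forallP/(_ (Ordinal ia)) => /= /eqP.
Qed.

Section Strips.
Variables a b : nat.
Implicit Types (mu rho : rpart a b) (p q r : rpart a b * rpart a b).

Lemma row_wt_inj mu rho : (forall i, (rowlen rho i <= rowlen mu i)%N) ->
  (wt mu <= wt rho)%N -> mu = rho.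
Proof.
move=> le_row le_wt; apply: row_inj => i.
case: (ltnP i a) => [ia|ai]; last by rewrite !row_over.
by apply/esym; apply: (@eq_leq_sum a _ _ le_row).
Qed.

Definition vstrip mu rho :=
  [forall i : 'I_a, rowlen rho i <= rowlen mu i <= (rowlen rho i).+1]%N.

Lemma vstripP mu rho :
  reflect (forall i, (rowlen rho i <= rowlen mu i <= (rowlen rho i).+1)%N) (vstrip mu rho).
Proof.
apply: (iffP forallP) => [h i|h i]; last exact: h.
case: (ltnP i a) => [ia|ai]; first exact: h (Ordinal ia).
by rewrite !row_over.
Qed.

Lemma vstrip_wt mu rho : vstrip mu rho -> (wt rho <= wt mu)%N.
Proof. by move/vstripP => vs; apply: leq_sum => i _; case/andP: (vs i). Qed.

(** The sum runs over the ways to go from mu to rho by removing a horizontal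
strip and then a vertical strip, and the row lengths of the intermediate shape
can be chosen independently.  If mu <> rho, let i be the last row in which they
differ: as mu and rho agree below i, row i of the intermediate shape may be
rowlen rho i or one more, whatever the other rows are, and exchanging these two
values changes the sign. *)
Lemma strip_sign mu rho :
  \sum_(s | vstrip s rho && hstrip mu s) (-1) ^+ (wt mu + wt s) = (mu == rho)%:R :> rat.
Proof.
have sandwich s : vstrip s rho && hstrip mu s ->
    forall i, (rowlen rho i <= rowlen s i)%N /\ (rowlen s i <= rowlen mu i)%N.
  by case/andP => /vstripP vs /hstripP hs i; have := vs i; have := hs i; lia.
case: eqVneq sandwich => [<-|mu_rho] sandwich.
  rewrite (big_pred1 mu) => [|s /=]; first by rewrite addnn -signr_odd odd_double.
  apply/idP/eqP => [/sandwich sw|->].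
    by apply: row_inj => i; have := sw i; lia.
  by apply/andP; split; [apply/vstripP|apply/hstripP] => i; have := row_leS mu i; lia.
pose Q s := vstrip s rho && hstrip mu s; rewrite -/(Q _).
case: (pickP Q) => [s0 /sandwich sw0|noQ]; last by rewrite big_pred0.
have le_rho i : (rowlen rho i <= rowlen mu i)%N by have := sw0 i; lia.
have [i0 lt_i0] : exists i0 : 'I_a, (rowlen rho i0 < rowlen mu i0)%N.
  apply/existsP; apply: contraNT mu_rho => /existsPn eq_row.
  by apply/eqP/row_inj => i; case: (ltnP i a) => ia;
     [have := eq_row (Ordinal ia); have := le_rho i => /=; lia | rewrite !row_over].
case: (@arg_maxnP _ i0 (fun i => rowlen rho i < rowlen mu i)%N (@nat_of_ord a) lt_i0).
move=> i lt_i max_i.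
have eq_above j : (i < j)%N -> rowlen mu j = rowlen rho j.
  move=> ij; case: (ltnP j a) => ja; last by rewrite !row_over.
  by have := max_i (Ordinal ja); have := le_rho j => /=; lia.
pose f (s : rpart a b) j :=
  if j == i :> nat then ((rowlen rho i).*2.+1 - rowlen s i)%N else rowlen s j.
have toggle s : Q s -> exists t, Q t /\ forall j, rowlen t j = f s j.
  case/andP => /vstripP vs /hstripP hs.
  have f_bounds j : (rowlen rho j <= f s j <= (rowlen rho j).+1)%N &&
                    (rowlen mu j.+1 <= f s j <= rowlen mu j)%N.
    rewrite /f; have := vs j; have := hs j; case: eqP => [->|]; last by lia.
    by have := eq_above _ (ltnSn i); have := row_leS rho i; lia.
  have [j ja|j ja|t tE] := @rpart_exists a b (f s).
  - by have := f_bounds j; have := row_leb mu j; lia.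
  - by have := f_bounds j; have := f_bounds j.+1; lia.
  have rowt j : rowlen t j = f s j.
    case: (ltnP j a) => ja; first exact: tE.
    by have := f_bounds j; rewrite !(row_over _ ja) row_over; lia.
  exists t; split=> //; apply/andP.
  by split; [apply/vstripP|apply/hstripP] => j; rewrite rowt; have := f_bounds j; lia.
(* The toggled shape is selected with a default, so that toggling is a total map. *)
pose tog (s : rpart a b) := odflt s [pick t | Q t && [forall j : 'I_a, rowlen t j == f s j]].
have togP s : Q s -> Q (tog s) /\ forall j, rowlen (tog s) j = f s j.
  move=> Qs; rewrite /tog; case: pickP => [t /andP[Qt /forallP tE]|noT] /=.
    split=> // j; case: (ltnP j a) => ja; first exact: eqP (tE (Ordinal ja)).
    by rewrite /f gtn_eqF ?(leq_trans _ ja) // !row_over.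
  have [t [Qt tE]] := toggle s Qs.
  by have := noT t; rewrite Qt; case/forallP => j; rewrite tE.
have togK s : Q s -> tog (tog s) = s.
  move=> Qs; have [Qt tE] := togP s Qs; have [_ ttE] := togP _ Qt.
  case/andP: (Qs) => /vstripP vs _.
  apply: row_inj => j; rewrite ttE /f !tE /f eqxx; case: eqP => // ->.
  by have := vs i; lia.
set S := \sum_(s | _) _.
rewrite mulr0n; suff: S = - S by move=> E; lra.
rewrite {1}/S (reindex_onto tog tog togK) -sumrN; apply: eq_big => [s|s].
  apply/andP/idP => [[Qt /eqP <-]|Qs]; first by have [] := togP _ Qt.
  by have [-> _] := togP s Qs; rewrite togK.
case/andP => Qt /eqP ttE; have Qs : Q s by rewrite -ttE; have [] := togP _ Qt.
have [_ tE] := togP s Qs; case/andP: (Qs) => /vstripP vs _.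
have odd_wt : odd (wt (tog s)) = ~~ odd (wt s).
  rewrite /wt (bigD1 i) // [in RHS](bigD1 i) //= tE /f eqxx.
  rewrite (eq_bigr (fun j : 'I_a => rowlen s j)) => [|j ji]; last first.
    by rewrite tE /f -(inj_eq val_inj) in ji *; rewrite (negPf ji).
  by have := vs i; lia.
by rewrite !exprD -[X in _ * X]signr_odd odd_wt signrN mulrN signr_odd.
Qed.

Definition vstrip2 p q := vstrip p.1 q.1 && vstrip p.2 q.2.

Lemma strip2_sign p q :
  \sum_(r | vstrip2 r q && hstrip2 p r) (-1) ^+ (wt2 p + wt2 r) = (p == q)%:R :> rat.
Proof.
have -> : (p == q)%:R = (p.1 == q.1)%:R * (p.2 == q.2)%:R :> rat.
  by case: p q => [p1 p2] [q1 q2]; rewrite -natrM mulnb.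
rewrite -!strip_sign big_distrlr pair_big /=; apply: eq_big => [r|r _].
  by rewrite /vstrip2 /hstrip2 andbACA.
by rewrite -exprD /wt2 addnACA.
Qed.

(** * Linear relations between products of two Schur functions *)

Definition relation (c : rpart a b * rpart a b -> rat) :=
  \sum_p c p *: schur2 p = 0.

Lemma pcoef_sum (I : finType) (P : pred I) (F : I -> powser) m :
  pcoef (\sum_(i | P i) F i) m = \sum_(i | P i) pcoef (F i) m.
Proof. by apply: (big_morph (pcoef^~ m)). Qed.

Lemma relationP c :
  relation c <-> forall m, \sum_p c p * pcoef (schur2 p) m = 0.
Proof.
split=> [rc m|rc].
  by have := congr1 (pcoef^~ m) rc; rewrite pcoef_sum.
by apply: powserP => m; rewrite pcoef_sum; exact: rc.
Qed.

Lemma relation_sum (I : finType) (x : I -> rat) (d : I -> _ -> rat) c :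
    (forall i, relation (d i)) -> (forall q, c q = \sum_i x i * d i q) ->
  relation c.
Proof.
move=> rd cE; apply/relationP => m.
under eq_bigr do rewrite cE mulr_suml.
rewrite exchange_big big1 //= => i _.
under eq_bigr do rewrite -mulrA.
by rewrite -mulr_sumr; have /relationP-> := rd i; rewrite mulr0.
Qed.

(** The coefficients of the relation that c becomes when horizontal strips with
k boxes in total are removed from both members of each pair. *)
Definition hop k c q : rat :=
  \sum_(p | hstrip2 p q && (wt2 p == wt2 q + k)%N) c p.

Definition vop k c q : rat :=
  \sum_(p | vstrip2 p q && (wt2 p == wt2 q + k)%N) c p.

(** The relation is read at the monomials m x_n^k, where the variables from n on
do not occur in m. *)
Lemma relation_hop k c : relation c -> relation (hop k c).
Proof.
move/relationP => rc; apply/relationP => m.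
pose n := (\max_(i <- finsupp m) i).+1.
have m_n i : (n <= i)%N -> m i = 0%N.
  move=> ni; apply/eqP; rewrite cmE_eq0; apply: contraL ni => im.
  by rewrite -ltnNge ltnS /n; apply: leq_bigmax_seq.
rewrite -[RHS](rc (setm m n k)).
under [RHS]eq_bigr => p _ do rewrite schur2_setm // mulr_sumr.
rewrite (exchange_big_dep predT) //=; apply: eq_bigr => q _.
by rewrite mulr_suml.
Qed.

Lemma hop0 c : hop 0 c =1 c.
Proof.
move=> q; rewrite /hop (big_pred1 q) // => p /=; rewrite addn0.
apply/andP/eqP => [[/andP[hs1 hs2] /eqP wtE]|->]; last first.
  by split=> //; apply/andP; split; apply/hstripP => i; rewrite row_leS leqnn.
have := hstrip_wt hs1; have := hstrip_wt hs2; move: wtE; rewrite /wt2 => wtE w1 w2.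
case: p q hs1 hs2 wtE w1 w2 => [p1 p2] [q1 q2] /= /hstripP hs1 /hstripP hs2 wtE w1 w2.
have -> : p1 = q1 by apply: row_wt_inj => [i|]; [have := hs1 i|]; lia.
by have -> : p2 = q2 by apply: row_wt_inj => [i|]; [have := hs2 i|]; lia.
Qed.

Lemma vop0 c : vop 0 c =1 c.
Proof.
move=> q; rewrite /vop (big_pred1 q) // => p /=; rewrite addn0.
apply/andP/eqP => [[/andP[hs1 hs2] /eqP wtE]|->]; last first.
  by split=> //; apply/andP; split; apply/vstripP => i; rewrite leqnSn leqnn.
have := vstrip_wt hs1; have := vstrip_wt hs2; move: wtE; rewrite /wt2 => wtE w1 w2.
case: p q hs1 hs2 wtE w1 w2 => [p1 p2] [q1 q2] /= /vstripP hs1 /vstripP hs2 wtE w1 w2.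
have -> : p1 = q1 by apply: row_wt_inj => [i|]; [have := hs1 i|]; lia.
by have -> : p2 = q2 by apply: row_wt_inj => [i|]; [have := hs2 i|]; lia.
Qed.

(** The relation between the complete and the elementary symmetric functions,
sum (-1)^i e_(n-i) h_i = 0 for n > 0, for the operators adjoint to them. *)
Lemma vop_hop_sum n c q : (0 < n)%N ->
  \sum_(i < n.+1) (-1) ^+ i * vop (n - i) (hop i c) q = 0.
Proof.
move=> n0.
transitivity (\sum_p \sum_(r | vstrip2 r q && hstrip2 p r)
  if wt2 p == (wt2 q + n)%N then c p * (-1) ^+ (wt2 p + wt2 r) else 0); last first.
  apply: big1 => p _; case: eqP => wtp; last by rewrite big1.
  rewrite -mulr_sumr strip2_sign; case: eqP => [pq|]; last by rewrite mulr0.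
  by move: wtp; rewrite pq; lia.
transitivity (\sum_(i < n.+1) \sum_p \sum_(r | (vstrip2 r q && hstrip2 p r) &&
   ((wt2 r == wt2 q + (n - i)) && (wt2 p == wt2 r + i))%N)
      c p * (-1) ^+ (wt2 p + wt2 r)).
  apply: eq_bigr => i _; rewrite (exchange_big_dep predT) //= mulr_sumr.
  rewrite [LHS]big_mkcond; apply: eq_bigr => r _.
  case: (boolP (_ && _)) => [/andP[vs wr]|]; last first.
    move=> h; rewrite big_pred0 // => p.
    by apply: contraNF h => /andP[/andP[-> _] /andP[-> _]].
  rewrite mulr_sumr; apply: eq_big => [p|p /andP[_ /eqP ->]].
    by rewrite vs wr.
  by rewrite mulrC addnAC addnn exprD -[X in _ * (X * _)]signr_odd odd_double mul1r.
rewrite exchange_big; apply: eq_bigr => p _ /=.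
rewrite (exchange_big_dep (fun r => vstrip2 r q && hstrip2 p r)) /=; last first.
  by move=> i r _ /andP[].
apply: eq_bigr => r /andP[/andP[vs1 vs2] /andP[hs1 hs2]].
have wq : (wt2 q <= wt2 r)%N by rewrite leq_add ?vstrip_wt.
have wp : (wt2 r <= wt2 p)%N by rewrite leq_add ?hstrip_wt.
rewrite /vstrip2 /hstrip2 vs1 vs2 hs1 hs2 /=.
case: eqP => wtp; last first.
  by rewrite big_pred0 // => i; apply/negP => /andP[/eqP E1 /eqP E2]; have := ltn_ord i; lia.
rewrite (big_pred1 (inord (wt2 p - wt2 r))) // => i /=.
apply/andP/eqP => [[/eqP E1 /eqP E2]|->].
  by apply/val_inj; rewrite /= inordK; have := ltn_ord i; lia.
by rewrite inordK; [split; apply/eqP|]; lia.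
Qed.

(** The term i = 0 of [vop_hop_sum] is [vop n c]; the others are obtained from the
relations [hop i c] by removing vertical strips with fewer boxes. *)
Lemma relation_vop k c : relation c -> relation (vop k c).
Proof.
elim/ltn_ind: k c => -[|n] IH c rc.
  apply: (relation_sum (I := unit) (x := fun=> 1) (d := fun=> c)) => // q.
  by rewrite vop0 (big_pred1 tt) ?mul1r //; case.
apply: (relation_sum (I := 'I_n.+1) (x := fun i => - (-1) ^+ i.+1)
  (d := fun i => vop (n - i) (hop i.+1 c))) => [i|q].
  by apply: IH; [rewrite ltnS leq_subr | apply: relation_hop].
have := vop_hop_sum c q (ltn0Sn n); rewrite big_ord_recl expr0 mul1r subn0.
rewrite (_ : vop n.+1 (hop 0 c) q = vop n.+1 c q); last first.
  by apply: eq_bigr => p _; rewrite hop0.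
move/eqP; rewrite addr_eq0 => /eqP ->; rewrite -sumrN.
by apply: eq_bigr => i _; rewrite mulNr subSS.
Qed.

End Strips.

(** * Stripping a rectangle down to a point *)

Section Stripping.
Variables a b : nat.
Implicit Types (p q : rpart a b * rpart a b) (c : rpart a b * rpart a b -> rat).

(** The two members of p are contained in the rectangle with h rows and w
columns and are complementary there; the rectangle shrinks while the ambient
a and b stay. *)
Definition complementary h w p :=
  (forall i, (i < h)%N -> (rowlen p.1 i + rowlen p.2 (h.-1 - i))%N = w) /\
  (forall i, (h <= i)%N -> rowlen p.1 i = 0%N /\ rowlen p.2 i = 0%N).

Definition swap p := (p.2, p.1).

(** For a pair which is complementary in a rectangle with h rows this says that
the members are equal or differ in the central box only: 2i + 1 = h selects the
middle row. *)
Definition near_equal h p :=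
  forall i, (i < h)%N -> (i.*2.+1 <> h -> rowlen p.1 i = rowlen p.2 i) /\
    (rowlen p.1 i <= (rowlen p.2 i).+1)%N /\ (rowlen p.2 i <= (rowlen p.1 i).+1)%N.

Definition supported (P : rpart a b * rpart a b -> Prop) c :=
  forall p, c p != 0 -> P p.

Lemma complementary_swap h w p : complementary h w p -> complementary h w (swap p).
Proof.
move=> [h1 h2]; split=> i hi /=; last by have [-> ->] := h2 i hi.
have := h1 (h.-1 - i)%N; rewrite subKn; last by lia.
by move=> <-; lia.
Qed.

Lemma pair_rowlen_inj p q : (forall i, rowlen p.1 i = rowlen q.1 i) ->
  (forall i, rowlen p.2 i = rowlen q.2 i) -> p = q.
Proof. by case: p q => [? ?] [? ?] /= *; congr pair; apply: row_inj. Qed.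

Lemma wt_recl (mu : rpart a b) :
  wt mu = (rowlen mu 0 + \sum_(i < a) rowlen mu i.+1)%N.
Proof.
rewrite -[RHS](big_ord_recl a (fun i : 'I_a.+1 => rowlen mu i)) big_ord_recr /=.
by rewrite (row_over _ (leqnn a)) addn0.
Qed.

(** Row i of rho is at least as long as row i + 1 of mu; thus a horizontal strip
has at most as many boxes as the first row, with equality only if rho is mu
without its first row. *)
Lemma wt_first_row (mu rho : rpart a b) : hstrip mu rho ->
  (wt mu <= rowlen mu 0 + wt rho)%N /\
  ((wt mu = rowlen mu 0 + wt rho)%N -> forall i, rowlen rho i = rowlen mu i.+1).
Proof.
move/hstripP => hs.
have le_row i : (rowlen mu i.+1 <= rowlen rho i)%N by case/andP: (hs i).
rewrite wt_recl leq_add2l; split; first by apply: leq_sum => i _.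
move/addnI => sumE i; case: (ltnP i a) => ia; last by rewrite !row_over // ltnW.
by apply/esym; apply: (@eq_leq_sum a _ _ le_row) => //; rewrite sumE.
Qed.

Lemma sum_first_column h (rho : rpart a b) :
  (\sum_(i < a) ((i < h) + rowlen rho i) = minn a h + wt rho)%N.
Proof.
rewrite big_split /=; congr addn; elim: (a) => [|n IHn]; first by rewrite big_ord0 min0n.
by rewrite big_ord_recr /= IHn; lia.
Qed.

(** A vertical strip has at most one box in each row, and equality forces one box
in each of the h rows. *)
Lemma wt_first_column h (mu rho : rpart a b) : vstrip mu rho ->
    (forall i, (h <= i)%N -> rowlen mu i = 0%N) ->
  (wt mu <= h + wt rho)%N /\
  ((wt mu = h + wt rho)%N -> forall i, rowlen mu i = ((i < h) + rowlen rho i)%N).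
Proof.
move/vstripP => vs mu0.
have le_row i : (rowlen mu i <= (i < h) + rowlen rho i)%N.
  by have := vs i; have := mu0 i; case: ltnP => //= hi; lia.
have le_wt : (wt mu <= minn a h + wt rho)%N.
  by rewrite -sum_first_column; apply: leq_sum.
have ah := geq_minr a h; split; first by lia.
move=> wtE i; case: (ltnP i a) => ia; last by rewrite !row_over // addn0; lia.
apply: (@eq_leq_sum a _ _ le_row) => //.
by rewrite sum_first_column -/(wt mu); lia.
Qed.

Lemma hstrip2_first_rows k p q : hstrip2 p q -> wt2 p = (wt2 q + k)%N ->
    (rowlen p.1 0 + rowlen p.2 0 <= k)%N ->
  [/\ (rowlen p.1 0 + rowlen p.2 0)%N = k,
      forall i, rowlen q.1 i = rowlen p.1 i.+1 &
      forall i, rowlen q.2 i = rowlen p.2 i.+1].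
Proof.
case/andP => /wt_first_row[le1 eq1] /wt_first_row[le2 eq2]; rewrite /wt2 => wtE lek.
by split; [|apply: eq1|apply: eq2]; lia.
Qed.

Lemma hstrip2_shift p q :
    (forall i, rowlen q.1 i = rowlen p.1 i.+1) ->
    (forall i, rowlen q.2 i = rowlen p.2 i.+1) ->
  hstrip2 p q && (wt2 p == wt2 q + (rowlen p.1 0 + rowlen p.2 0))%N.
Proof.
move=> q1 q2; have wtE (mu rho : rpart a b) :
    (forall i, rowlen rho i = rowlen mu i.+1) -> wt mu = (rowlen mu 0 + wt rho)%N.
  by move=> rhoE; rewrite wt_recl /wt; under [in RHS]eq_bigr do rewrite rhoE.
rewrite /wt2 (wtE _ _ q1) (wtE _ _ q2); apply/andP; split; last by apply/eqP; lia.
by apply/andP; split; apply/hstripP => i; rewrite ?q1 ?q2 leqnn row_leS.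
Qed.

Lemma vstrip2_first_columns h w p q : complementary h w p -> vstrip2 p q ->
    wt2 p = (wt2 q + h.*2)%N ->
  (forall i, rowlen p.1 i = ((i < h) + rowlen q.1 i)%N) /\
  (forall i, rowlen p.2 i = ((i < h) + rowlen q.2 i)%N).
Proof.
move=> [_ cp] /andP[vs1 vs2].
have [le1 eq1] := wt_first_column vs1 (fun i hi => (cp i hi).1).
have [le2 eq2] := wt_first_column vs2 (fun i hi => (cp i hi).2).
by rewrite /wt2 => wtE; split; [apply: eq1|apply: eq2]; lia.
Qed.

Lemma vstrip2_shift h p q : (h <= a)%N ->
    (forall i, rowlen p.1 i = ((i < h) + rowlen q.1 i)%N) ->
    (forall i, rowlen p.2 i = ((i < h) + rowlen q.2 i)%N) ->
  vstrip2 p q && (wt2 p == wt2 q + h.*2)%N.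
Proof.
move=> ha p1 p2; have wtE (mu rho : rpart a b) :
    (forall i, rowlen mu i = ((i < h) + rowlen rho i)%N) -> wt mu = (h + wt rho)%N.
  move=> muE; rewrite /wt; under eq_bigr do rewrite muE.
  by rewrite sum_first_column (minn_idPr ha).
rewrite /wt2 (wtE _ _ p1) (wtE _ _ p2); apply/andP; split; last by apply/eqP; lia.
by apply/andP; split; apply/vstripP => i; rewrite ?p1 ?p2; case: ltnP => _; rewrite /=; lia.
Qed.

(** The operations move a single coefficient when, within the support, only p
goes to q. *)
Lemma transport (P : rpart a b * rpart a b -> Prop) (B : rel (rpart a b * rpart a b)) c p q :
    supported P c -> P p -> B p q ->
    (forall p', P p' -> B p' q -> p' = p) ->
  \sum_(p' | B p' q) c p' = c p.
Proof.
move=> cP Pp Bp uniq_p; rewrite (bigD1 p) //= big1 ?addr0 // => p' /andP[Bp' p'p].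
apply/eqP; apply: contraNT p'p => /cP Pp'; exact/eqP/uniq_p.
Qed.

Lemma supported_sum (P P' : rpart a b * rpart a b -> Prop)
    (B : rel (rpart a b * rpart a b)) c :
    supported P c -> (forall p q, P p -> B p q -> P' q) ->
  supported P' (fun q => \sum_(p | B p q) c p).
Proof.
move=> cP BP q; case: (pselect (P' q)) => // nP'q /eqP[].
apply: big1 => p Bp; apply/eqP; rewrite -[_ == _]negbK; apply/negP => /cP Pp.
exact: nP'q (BP _ _ Pp Bp).
Qed.

(** This is where a relation is seen to have content: the last product left is
not zero. *)
Lemma schur_empty (mu : rpart a b) : (forall i, rowlen mu i = 0%N) ->
  schur (parts mu) = 1.
Proof.
move=> mu0; apply: powserP => m /=; rewrite -/(ssyt mu m).
have partsE : parts mu = nseq a 0%N.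
  apply: (@eq_from_nth _ 0%N); first by rewrite size_parts size_nseq.
  by move=> i _; rewrite nth_nseq if_same; apply: mu0.
have shape_nil (T : seq (seq nat)) : map size T = parts mu -> T = nseq a [::].
  move=> shT; apply: (@eq_from_nth _ [::]); first by rewrite size_nseq (shape_size shT).
  by move=> i _; rewrite nth_nseq if_same; apply/nilP; rewrite /nilp (shape_row i shT) mu0.
have flat_nil : flatten (nseq a [::]) = [::] :> seq nat by elim: (a).
rewrite (_ : ssyt mu m = if m == mone then [fset nseq a [::]]%fset else fset0).
  by case: eqP; rewrite ?cardfs1 ?cardfs0.
apply/fsetP => T; rewrite in_ssyt; apply/idP/idP => [|].
  case/andP => /is_ssytP[/shape_nil -> _ _] /asboolP; rewrite flat_nil => m0.
  rewrite (_ : m = mone) ?eqxx ?in_fset1 //.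
  by apply/eqP/cmP => i; rewrite -m0 cm1.
case: eqP => // ->; rewrite in_fset1 => /eqP ->; apply/andP; split.
  apply/is_ssytP; split=> [|i|i j]; last by rewrite mu0.
    by rewrite map_nseq partsE.
  by rewrite nth_nseq if_same.
by apply/asboolP => i; rewrite flat_nil cm1.
Qed.

Lemma relation_empty c p : relation c ->
    (forall i, rowlen p.1 i = 0%N) -> (forall i, rowlen p.2 i = 0%N) ->
    supported (eq^~ p) c ->
  c p = 0.
Proof.
move=> rc p1 p2 cp; move: rc; rewrite /relation (bigD1 p) //= big1 ?addr0; last first.
  move=> q qp; rewrite (_ : c q = 0) ?scale0r //.
  by apply/eqP; apply: contraNT qp => /cp ->.
rewrite /schur2 !schur_empty // mulr1 => /(congr1 (pcoef^~ mone)) /=.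
by rewrite eqxx mulr1.
Qed.

(** In the one-box rectangle the only complementary pairs are p and swap p;
removing the box sends both to the pair of empty partitions. *)
Lemma relation_unit_box c p : relation c -> supported (complementary 1 1) c ->
  complementary 1 1 p -> c p + c (swap p) = 0.
Proof.
move=> rc cs cp; have [z _ z0] : exists2 z : rpart a b, True & forall i, rowlen z i = 0%N.
  have [//|//|z zE] := @rpart_exists a b (fun=> 0%N).
  by exists z => // i; case: (ltnP i a) => ia; [apply: zE | rewrite row_over].
have box p' q' : complementary 1 1 p' -> hstrip2 p' q' && (wt2 p' == wt2 q' + 1)%N ->
    q' = (z, z).
  move=> [c1 c2] /andP[hs /eqP wtE]; have := c1 0%N isT; rewrite subnn => p0.
  have [|_ q1 q2] := hstrip2_first_rows hs wtE; first by rewrite p0.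
  by apply: pair_rowlen_inj => i /=; rewrite z0 ?q1 ?q2; have [] := c2 i.+1 isT.
have box_z p' : complementary 1 1 p' -> hstrip2 p' (z, z) && (wt2 p' == wt2 (z, z) + 1)%N.
  move=> [c1 c2]; have := c1 0%N isT; rewrite subnn => <-.
  by apply: hstrip2_shift => i; rewrite z0; have [] := c2 i.+1 isT.
have : hop 1 c (z, z) = 0.
  apply: (relation_empty (relation_hop 1 rc)) => //.
  by apply: (supported_sum cs) => p' q' cp'; apply: box cp'.
have c0 := cp.1 0%N isT; rewrite subnn in c0.
have p_swap : swap p != p.
  by apply/eqP => sp; move: c0; rewrite -[in X in rowlen X.1]sp /= ; lia.
rewrite /hop (bigD1 p) ?box_z //= (bigD1 (swap p)) /=; last first.
  by rewrite p_swap box_z //; apply: complementary_swap.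
rewrite big1 ?addr0 // => p' /andP[/andP[_ p'p] p's].
apply/eqP; apply: contraNT p's => /cs[c1 c2].
have := c1 0%N isT; rewrite subnn => c1'.
have [c21 c22] : (forall i, rowlen p.1 i.+1 = 0%N) /\ (forall i, rowlen p.2 i.+1 = 0%N).
  by split=> i; have [] := cp.2 i.+1 isT.
have c2' i := c2 i.+1 isT.
have [p01|p01] : rowlen p'.1 0 = rowlen p.1 0 \/ rowlen p'.1 0 = rowlen p.2 0 by lia.
  by case/eqP: p'p; apply: pair_rowlen_inj => -[|i]; rewrite ?c21 ?c22;
     [lia | have [] := c2' i | lia | have [] := c2' i].
by apply/eqP/pair_rowlen_inj => -[|i] /=; rewrite ?c21 ?c22;
   [lia | have [] := c2' i | lia | have [] := c2' i].
Qed.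

(** Both first rows have length at most w, so that removing 2w boxes in
horizontal strips deletes two full rows; by complementarity the last rows of the
rectangle are then empty, which leaves a rectangle with h rows. *)
Lemma complementary_strip_rows h w p q : complementary h.+2 w p ->
    hstrip2 p q && (wt2 p == wt2 q + w.*2)%N ->
  [/\ forall i, rowlen p.1 i = if i is j.+1 then rowlen q.1 j else w,
      forall i, rowlen p.2 i = if i is j.+1 then rowlen q.2 j else w &
      complementary h w q].
Proof.
move=> [c1 c2] /andP[hs /eqP wtE].
have := c1 0%N isT; have := c1 h.+1 (ltnSn _); rewrite /= subnn subn0 => c1h c10.
have [|p0 q1 q2] := hstrip2_first_rows hs wtE; first by lia.
have [p1w p2w] : rowlen p.1 0 = w /\ rowlen p.2 0 = w by lia.
split=> [[|i]//|[|i]//|]; split=> i hi; rewrite q1 q2.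
  have := c1 i.+1; rewrite (_ : (h.+2.-1 - i.+1 = (h.-1 - i).+1)%N); last by lia.
  by apply; lia.
case: (leqP h.+2 i.+1) => [/c2//|hi']; have -> : i = h by lia.
by have := c1 h.+1 (ltnSn _); have := c1 0%N isT; rewrite /= subnn subn0; lia.
Qed.

(** Removing 2h boxes in vertical strips deletes two full columns; by
complementarity the last columns of the rectangle are then empty. *)
Lemma complementary_strip_columns h w p q : complementary h w.+2 p ->
    vstrip2 p q && (wt2 p == wt2 q + h.*2)%N ->
  [/\ forall i, rowlen p.1 i = ((i < h) + rowlen q.1 i)%N,
      forall i, rowlen p.2 i = ((i < h) + rowlen q.2 i)%N &
      complementary h w q].
Proof.
move=> cp /andP[vs /eqP wtE]; have [p1 p2] := vstrip2_first_columns cp vs wtE.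
case: cp => c1 c2; split=> //; split=> i hi.
  have := c1 i hi; rewrite p1 p2 hi (_ : (h.-1 - i < h)%N); last by lia.
  by lia.
by have := c2 i hi; rewrite p1 p2 ltnNge hi.
Qed.

Lemma rpart_pair_exists (f g : nat -> nat) :
    (forall i, (f i.+1 <= f i <= b)%N) -> (forall i, (g i.+1 <= g i <= b)%N) ->
    (forall i, (a <= i)%N -> f i = 0%N /\ g i = 0%N) ->
  exists q : rpart a b * rpart a b,
    (forall i, rowlen q.1 i = f i) /\ (forall i, rowlen q.2 i = g i).
Proof.
move=> fP gP fg0.
have [i _|i _|mu muE] := @rpart_exists a b f; try by have := fP i; lia.
have [i _|i _|nu nuE] := @rpart_exists a b g; try by have := gP i; lia.
exists (mu, nu); split=> i /=; case: (ltnP i a) => ia.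
- exact: muE.
- by rewrite row_over //; have [] := fg0 i ia.
- exact: nuE.
- by rewrite row_over //; have [] := fg0 i ia.
Qed.

(** Induction on the size of the rectangle: for a pair of nearly equal
complementary partitions both first rows or both first columns are full, unless
the rectangle is empty or has a single box. *)
Lemma relation_near_equal h w c p :
    relation c -> supported (complementary h w) c ->
    complementary h w p -> near_equal h p ->
  c p + c (swap p) = 0.
Proof.
have [n] := ubnP (h + w); elim: n h w c p => // n IH h w c p; rewrite ltnS => hwn rc cs.
move=> cp np.
case: (boolP ((h == 0) || (w == 0))%N) => [hw0|hw_gt0].
  have cp0 q : complementary h w q ->
      forall i, rowlen q.1 i = 0%N /\ rowlen q.2 i = 0%N.
    move=> [c1 c2] i; case: (ltnP i h) => [ih|]; last exact: c2.
    have e1 := c1 i ih; have := c1 (h.-1 - i)%N ltac:(lia).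
    by rewrite subKn; lia.
  have c0 q : complementary h w q -> c q = 0.
    move=> cq; apply: relation_empty rc _ _ _ => [i|i|q' /cs cq'].
    - by have [] := cp0 q cq i.
    - by have [] := cp0 q cq i.
    - by apply: pair_rowlen_inj => i; have [x y] := cp0 q cq i;
         have [x' y'] := cp0 q' cq' i; lia.
  by rewrite !c0 ?addr0 //; apply: complementary_swap.
have csw := complementary_swap cp.
have h_gt0 : (0 < h)%N by lia.
have := cp.1 0%N h_gt0; have := cp.1 h.-1; rewrite subnn subn0 => /(_ _) c1h c10.
have {}c1h := c1h ltac:(lia).
have [ne1 [ne2 ne3]] := np h.-1 ltac:(lia).
have [ne4 [ne5 ne6]] := np 0%N h_gt0.
have mono := row_le p.1 (leq0n h.-1).
have mono' := row_le p.2 (leq0n h.-1).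
(* Only for h = 1 is the first or the last row the middle one; the members may
   then differ by one box, which for w > 1 leaves both of them nonempty. *)
have [hw1|[[h2 p1w p2w]|[w2 p1 p2]]] : (h = 1 /\ w = 1)%N \/
    [/\ (1 < h)%N, rowlen p.1 0 = w & rowlen p.2 0 = w] \/
    [/\ (1 < w)%N, (0 < rowlen p.1 h.-1)%N & (0 < rowlen p.2 h.-1)%N].
- case: (eqVneq h 1%N) => [h1|h1].
    rewrite h1 /= in c1h c10 ne2 ne3 *.
    case: (eqVneq w 1%N) => [w1|w1]; [by left|right; right].
    by split; lia.
  have e1 : rowlen p.1 h.-1 = rowlen p.2 h.-1 by apply: ne1; lia.
  have e0 : rowlen p.1 0 = rowlen p.2 0 by apply: ne4; lia.
  case: (posnP (rowlen p.1 h.-1)) => [l0|l_gt0]; [right; left|right; right]; split; lia.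
- by case: hw1 => h1 w1; rewrite h1 w1 in cp cs; apply: relation_unit_box.
- clear c1h c10 h_gt0 hw_gt0 ne1 ne2 ne3 ne4 ne5 ne6 mono mono'.
  case: h h2 hwn cs cp csw np => [|[|h]] // _.
  move=> hwn cs cp csw np.
  have [||i ai|q [q1 q2]] :=
      @rpart_pair_exists (fun i => rowlen p.1 i.+1) (fun i => rowlen p.2 i.+1).
  + by move=> i; rewrite row_leS row_leb.
  + by move=> i; rewrite row_leS row_leb.
  + by rewrite !row_over // ltnW.
  have Bp : hstrip2 p q && (wt2 p == wt2 q + w.*2)%N.
    by rewrite -addnn -{1}p1w -p2w; apply: hstrip2_shift.
  have Bs : hstrip2 (swap p) (swap q) && (wt2 (swap p) == wt2 (swap q) + w.*2)%N.
    by rewrite -addnn -{1}p2w -p1w; apply: hstrip2_shift.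
  have uniq_p p0 q0 : complementary h.+2 w p0 -> hstrip2 p0 q0 && (wt2 p0 == wt2 q0 + w.*2)%N ->
      forall p', complementary h.+2 w p' -> hstrip2 p' q0 && (wt2 p' == wt2 q0 + w.*2)%N ->
      p' = p0.
    move=> cp0 /(complementary_strip_rows cp0)[e1 e2 _] p' cp'.
    case/(complementary_strip_rows cp') => e1' e2' _.
    by apply: pair_rowlen_inj => i; rewrite ?e1 ?e1' ?e2 ?e2'.
  have [_ _ cq] := complementary_strip_rows cp Bp.
  pose B p0 q0 := hstrip2 p0 q0 && (wt2 p0 == wt2 q0 + w.*2)%N.
  have <- : hop w.*2 c q = c p by apply: (@transport _ B c p q cs cp Bp); apply: uniq_p.
  have <- : hop w.*2 c (swap q) = c (swap p).
    by apply: (@transport _ B c _ _ cs csw Bs); apply: uniq_p.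
  apply: (IH h w) => //; first by lia.
  + exact: relation_hop.
  + by apply: (supported_sum cs) => p' q' cp' /(complementary_strip_rows cp')[].
  + move=> i ih; rewrite q1 q2; have [e [l1 l2]] := np i.+1 ltac:(lia).
    by split=> // ne; apply: e; lia.
case: w w2 hwn cs cp csw {c1h c10 hw_gt0 ne1 ne2 ne3 ne4 ne5 ne6} => [|[|w]] // _.
move=> hwn cs cp csw.
have ha : (h <= a)%N.
  by rewrite leqNgt; apply/negP => ah; move: p1; rewrite row_over //; lia.
have [||i ai|q [q1 q2]] :=
    @rpart_pair_exists (fun i => (rowlen p.1 i).-1) (fun i => (rowlen p.2 i).-1).
- by move=> i; have := row_leS p.1 i; have := row_leb p.1 i; lia.
- by move=> i; have := row_leS p.2 i; have := row_leb p.2 i; lia.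
- by rewrite !row_over.
have e1 i : rowlen p.1 i = ((i < h) + rowlen q.1 i)%N.
  rewrite q1; case: ltnP => hi; last by have [-> _] := cp.2 i hi.
  by have := @row_le _ _ p.1 i h.-1; lia.
have e2 i : rowlen p.2 i = ((i < h) + rowlen q.2 i)%N.
  rewrite q2; case: ltnP => hi; last by have [_ ->] := cp.2 i hi.
  by have := @row_le _ _ p.2 i h.-1; lia.
have Bp := @vstrip2_shift h p q ha e1 e2.
have Bs := @vstrip2_shift h (swap p) (swap q) ha e2 e1.
have uniq_p p0 q0 : complementary h w.+2 p0 -> vstrip2 p0 q0 && (wt2 p0 == wt2 q0 + h.*2)%N ->
    forall p', complementary h w.+2 p' -> vstrip2 p' q0 && (wt2 p' == wt2 q0 + h.*2)%N ->
    p' = p0.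
  move=> cp0 /(complementary_strip_columns cp0)[f1 f2 _] p' cp'.
  case/(complementary_strip_columns cp') => f1' f2' _.
  by apply: pair_rowlen_inj => i; rewrite ?f1 ?f1' ?f2 ?f2'.
have [_ _ cq] := complementary_strip_columns cp Bp.
pose B p0 q0 := vstrip2 p0 q0 && (wt2 p0 == wt2 q0 + h.*2)%N.
have <- : vop h.*2 c q = c p by apply: (@transport _ B c p q cs cp Bp); apply: uniq_p.
have <- : vop h.*2 c (swap q) = c (swap p).
  by apply: (@transport _ B c _ _ cs csw Bs); apply: uniq_p.
apply: (IH h w) => //; first by lia.
- exact: relation_vop.
- by apply: (supported_sum cs) => p' q' cp' /(complementary_strip_columns cp')[].
- by move=> i ih; have := np i ih; rewrite e1 e2; lia.
Qed.

End Stripping.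

(** * Relations indexed by unordered pairs *)

Section UnorderedPairs.
Variables a b : nat.
Implicit Types la mu : rpart a b.

Lemma mem_cpair la mu : (cpair mu == cpair la) = (mu \in cpair la).
Proof.
apply/eqP/idP => [<-|]; first by rewrite in_set2 eqxx.
rewrite in_set2 => /orP[] /eqP -> //.
by rewrite /cpair complementK finset.setUC.
Qed.

Lemma rowlen_complement la i : (i < a)%N ->
  rowlen (complement la) i = (b - rowlen la (a.-1 - i))%N.
Proof.
move=> ia; rewrite (rowlenE _ (Ordinal ia)) complementE -rowlenE /=.
by congr (_ - rowlen _ _)%N; lia.
Qed.

Lemma complementary_complement la : complementary a b (la, complement la).
Proof.
split=> i ia /=; last by rewrite !row_over.
rewrite rowlen_complement; last by lia.
by rewrite subKn; [have := row_leb la i | ]; lia.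
Qed.

(** Only the middle row may differ, and there two differing boxes would be two
boxes of the symmetric difference. *)
Lemma near_equal_almost la : odd a -> almost_selfcomplementary la ->
  near_equal a (la, complement la).
Proof.
move=> a_odd /eqP/setP center i ia /=.
have centerE j : (j < b)%N ->
    ((j < rowlen la i) != (j < rowlen (complement la) i))%N =
    ((i == a./2) && (j == b./2)).
  move=> jb; have := center (Ordinal ia, Ordinal jb).
  rewrite !inE -!(rowlenE _ (Ordinal ia)) => <- /=.
  by case: (j < rowlen la i)%N; case: (j < _)%N.
have lb := row_leb la i; have lb' := row_leb (complement la) i.
have out j : (j < b)%N -> ~~ ((i == a./2) && (j == b./2)) ->
    (j < rowlen la i)%N = (j < rowlen (complement la) i)%N.
  by move=> jb /negPf; rewrite -centerE // => /negbFE /eqP.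
have two x y : (x < b)%N -> (y < b)%N -> x != y ->
    (x < rowlen la i)%N = (x < rowlen (complement la) i)%N \/
    (y < rowlen la i)%N = (y < rowlen (complement la) i)%N.
  move=> xb yb xy; case: (eqVneq x b./2) => [xE|xE]; last first.
    by left; apply: out => //; rewrite negb_and xE orbT.
  by right; apply: out => //; rewrite negb_and -xE (eq_sym y) xy orbT.
set l := rowlen la i in lb out two *; set l' := rowlen _ i in lb' out two *.
split; last split.
- move=> i_mid; have i_ne : i != a./2 by apply/eqP => iE; apply: i_mid; rewrite iE; lia.
  case: (ltngtP l l') => // ll.
    by have := out l ltac:(lia); rewrite (negPf i_ne) /= => /(_ isT); lia.
  by have := out l' ltac:(lia); rewrite (negPf i_ne) /= => /(_ isT); lia.
- rewrite leqNgt; apply/negP => ll.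
  by have := two l' l'.+1 ltac:(lia) ltac:(lia) ltac:(lia); lia.
rewrite leqNgt; apply/negP => ll.
by have := two l l.+1 ltac:(lia) ltac:(lia) ltac:(lia); lia.
Qed.

(** Dividing by the number of members of the unordered pair turns a relation
indexed by unordered pairs into one indexed by ordered pairs. *)
Lemma cpair_independent (J : {set {set rpart a b}}) (k : {set rpart a b} -> rat) :
    (forall P, P \in J -> exists mu, P = cpair mu) ->
    \sum_(P in J) k P *: cpair_prod P = 0 ->
  forall la, near_equal a (la, complement la) -> cpair la \in J ->
  k (cpair la) = 0.
Proof.
move=> Jc relJ la near_la laJ.
pose c (p : rpart a b * rpart a b) :=
  if (p.2 == complement p.1) && (cpair p.1 \in J)
  then k (cpair p.1) / #|cpair p.1|%:R else 0.
have card_gt0 mu : (#|cpair mu|%:R != 0 :> rat).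
  by rewrite Num.Theory.pnatr_eq0 -lt0n; apply/card_gt0P; exists mu; rewrite in_set2 eqxx.
have rc : relation c.
  rewrite /relation; transitivity (\sum_mu \sum_nu c (mu, nu) *: schur2 (mu, nu)).
    by rewrite pair_big; apply: eq_bigr => -[].
  rewrite -[RHS]relJ.
  transitivity (\sum_(mu | cpair mu \in J)
      (k (cpair mu) / #|cpair mu|%:R) *: cpair_prod (cpair mu)).
    rewrite [RHS]big_mkcond; apply: eq_bigr => mu _.
    rewrite (bigD1 (complement mu)) //= big1 ?addr0 => [|nu /negPf nu_mu].
      by rewrite /c /= eqxx /=; case: ifP => _; rewrite ?scale0r ?cpair_prodE.
    by rewrite /c /= nu_mu scale0r.
  rewrite (partition_big (@cpair a b) (mem J)) //=; apply: eq_bigr => P PJ.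
  have [nu PE] := Jc P PJ; rewrite (eq_big (mem P) (fun=> (k P / #|P|%:R) *: cpair_prod P)).
  - rewrite sumr_const -scaler_nat scalerA mulrCA mulfV ?mulr1 //.
    by rewrite PE.
  - move=> mu; rewrite PE mem_cpair /= andb_idl // => mu_nu.
    by rewrite (eqP (_ : cpair mu == cpair nu)) ?mem_cpair // -PE.
  by move=> mu /andP[_ /eqP ->].
have cs : supported (complementary a b) c.
  move=> [mu nu]; rewrite /c /=; case: (eqVneq nu (complement mu)) => [->|_]; last by rewrite eqxx.
  by move=> _; apply: complementary_complement.
have := relation_near_equal rc cs (complementary_complement la) near_la.
have cE mu : cpair mu = cpair la -> c (mu, complement mu) = k (cpair la) / #|cpair la|%:R.
  by move=> muE; rewrite /c /= eqxx muE laJ.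
have -> : swap (la, complement la) = (complement la, complement (complement la)).
  by rewrite /swap complementK.
rewrite !cE //; last by apply/eqP; rewrite mem_cpair in_set2 eqxx orbT.
move=> kk; have /eqP : k (cpair la) / #|cpair la|%:R = 0 by lra.
by rewrite mulf_eq0 invr_eq0 (negPf (card_gt0 la)) orbF => /eqP.
Qed.

End UnorderedPairs.

Theorem mainTheorem1 (a b : nat) (a_gt0 : (0 < a)%N) (b_gt0 : (0 < b)%N) :
  (forall k : {set rpart a b} -> rat,
     \sum_(P in [set cpair mu | mu : rpart a b]) k P *: cpair_prod P = 0 ->
     forall la : rpart a b, la = complement la -> k (cpair la) = 0)
  /\
  (odd a -> odd b ->
   forall k : {set rpart a b} -> rat,
     \sum_(P in [set cpair mu | mu : rpart a b & almost_selfcomplementary mu])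
        k P *: cpair_prod P = 0 ->
     forall la : rpart a b, almost_selfcomplementary la -> k (cpair la) = 0).
Proof.
split=> [k rel_k la la_self|a_odd _ k rel_k la la_almost].
  apply: (cpair_independent _ rel_k) => [P /imsetP[mu _ ->]||].
  - by exists mu.
  - by rewrite -la_self => i ia /=.
  - exact: imset_f.
apply: (cpair_independent _ rel_k) => [P /imsetP[mu _ ->]||].
- by exists mu.
- exact: near_equal_almost.
- by apply: imset_f; rewrite inE.
Qed.
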